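(* Let $A,B\in\mathbb{M}_n$ and let $f:[0,\infty)\to[0,\infty)$ be concave. Then there exist unitaries $U,V\in\mathbb{M}_n$ such that $$f\bigl(|A+B|_{\mathrm{qsym}}\bigr)\le Uf\bigl(|A|_{\mathrm{qsym}}\bigr)U^*+Vf\bigl(|B|_{\mathrm{qsym}}\bigr)V^*.$$
   Context: $\mathbb{M}_n$ is the space of $n\times n$ complex matrices. For $Z\in\mathbb{M}_n$, the quadratic symmetric modulus is $|Z|_{\mathrm{qsym}}=\left(\frac{Z^*Z+ZZ^*}{2}\right)^{1/2}$. For a positive semidefinite matrix $X$, $f(X)$ is defined by the spectral functional calculus. For Hermitian matrices, $X\le Y$ means $Y-X$ is positive semidefinite. *)

(* Defs.v *)
From mathcomp Require Import all_boot all_order all_algebra.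
From mathcomp Require Import spectral sesquilinear complex.
From mathcomp Require Import interval_inference.
From mathcomp Require Import all_classical all_reals convex.

Set Implicit Arguments.
Unset Strict Implicit.
Unset Printing Implicit Defensive.

Import Order.TTheory GRing.Theory Num.Theory.

Local Open Scope ring_scope.
Local Open Scope sesquilinear_scope.
Local Open Scope complex_scope.

(* In R[i], [0 <= z] says that z is real and nonnegative. *)
Definition psdmx (R : rcfType) (n : nat) (X : 'M[R[i]]_n) : Prop :=
  X \is hermsymmx /\ forall v : 'cV[R[i]]_n, 0 <= (v ^t* *m X *m v) 0 0.

(* Meant for Hermitian X and Y. *)
Definition loewner_le (R : rcfType) (n : nat) (X Y : 'M[R[i]]_n) : Prop :=
  psdmx (Y - X).

(* For X normal, X = P^* D P with P = [spectralmx X] unitary and D diagonal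
   with diagonal [spectral_diag X] ([orthomx_spectralP]); [fun_calc_diag] below
   shows that any other unitary diagonalization gives the same result.  For X
   Hermitian D is real, so that taking real parts only changes the type of the
   eigenvalues; for other X the value is meaningless. *)
Definition fun_calc (R : rcfType) (n : nat) (f : R -> R) (X : 'M[R[i]]_n) :
    'M[R[i]]_n :=
  (spectralmx X) ^t*
    *m diag_mx (map_mx (fun z => (f (complex.Re z))%:C) (spectral_diag X))
    *m spectralmx X.

Definition sqrtmx (R : rcfType) (n : nat) (X : 'M[R[i]]_n) : 'M[R[i]]_n :=
  fun_calc (@Num.sqrt R) X.

Definition qsym (R : rcfType) (n : nat) (Z : 'M[R[i]]_n) : 'M[R[i]]_n :=
  sqrtmx (2^-1 *: (Z ^t* *m Z + Z *m Z ^t*)).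

(* The values of f outside [0, +oo) are not constrained. *)
Definition concave_nneg (R : realType) (f : R -> R) : Prop :=
  convex_function (`[0%R, +oo[%classic : set R^o) (fun x : R^o => - f x : R).

Lemma concave_nnegP (R : realType) (f : R -> R) :
  concave_nneg f <->
  forall x y t : R, 0 <= x -> 0 <= y -> 0 <= t <= 1 ->
    t * f x + (1 - t) * f y <= f (t * x + (1 - t) * y).
Proof.
split=> [cf x y t x0 y0 /andP[t0 t1]|cf t x y].
  have := cf (Itv01 t0 t1) x y.
  rewrite !inE/= !in_itv/= !andbT => /(_ x0 y0).
  by rewrite !convRE/= !mulrN -opprD lerN2.
rewrite !inE/= !in_itv/= !andbT => x0 y0.
rewrite !convRE/= !mulrN -opprD lerN2.
by apply: cf => //; rewrite ge0 le1.
Qed.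

Lemma fun_calc_diag (R : rcfType) (n : nat) (f : R -> R)
    (P : 'M[R[i]]_n) (d : 'rV[R[i]]_n) :
  P \is unitarymx ->
  fun_calc f (P ^t* *m diag_mx d *m P) =
  P ^t* *m diag_mx (map_mx (fun z => (f (complex.Re z))%:C) d) *m P.
Proof.
move=> Pu; set X := P ^t* *m _ *m P.
have Xn : X \is normalmx.
  by apply/orthomx_spectral_subproof; exists (P, d); rewrite //= invmx_unitary.
have Qu := spectral_unitarymx X.
have XE := orthomx_spectralP Xn; move: XE Qu; rewrite /fun_calc.
move: (spectralmx X) (spectral_diag X) => Q s XE Qu.
rewrite (invmx_unitary Qu) in XE.
have PPt : P *m P ^t* = 1%:M by apply/unitarymxP.
have QQt : Q *m Q ^t* = 1%:M by apply/unitarymxP.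
have PtP : P ^t* *m P = 1%:M by apply: mulmx1C.
have QtQ : Q ^t* *m Q = 1%:M by apply: mulmx1C.
pose W := Q *m P ^t*.
have WE : W *m diag_mx d = diag_mx s *m W.
  transitivity (Q *m X *m P ^t*).
    by rewrite /X /W -!mulmxA PPt mulmx1.
  by rewrite XE /W !mulmxA QQt mul1mx.
set g := fun z => _.
have WgE : W *m diag_mx (map_mx g d) = diag_mx (map_mx g s) *m W.
  move: (W) WE => W' WE; apply/matrixP => i j; move/matrixP/(_ i j): WE.
  rewrite !mul_mx_diag !mul_diag_mx !mxE.
  have [-> _|Wn] := eqVneq (W' i j) 0; first by rewrite mul0r mulr0.
  by rewrite mulrC => /(mulIf Wn) ->; rewrite mulrC.
transitivity (Q ^t* *m (diag_mx (map_mx g s) *m W) *m P).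
  by rewrite /W -!mulmxA PtP mulmx1.
by rewrite -WgE /W !mulmxA QtQ mul1mx.
Qed.

(* Main.v *)
(* Up to the factor [sqrt(1/2)], |Z|_qsym is the modulus |S| of the stacked
   matrix S of Z and Z^*, and Z |-> S is additive.  So the statement is a
   concave Thompson inequality
     f(|S+T|) <= U f(|S|) U^* + V f(|T|) V^*.
   Thompson's inequality itself comes from |S+T| = Re(W^*S) + Re(W^*T) with W
   the contraction (S+T)|S+T|^+, each summand being dominated, eigenvalue by
   eigenvalue, by |S| or |T|.  This reduces the matter to the subadditivity
   f(X+Y) <= U f(X) U^* + V f(Y) V^* for X, Y >= 0, where f(0) = 0 without loss
   of generality.  With K = X+Y and G = (f(K)/K)^(1/2) one has
   f(K) = GKG = GXG + GYG, and GXG is isospectral to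
   X^(1/2) K^(-1/2) f(K) K^(-1/2) X^(1/2), which f(X) dominates by Jensen's
   inequality, K^(-1/2) X^(1/2) being a contraction. *)
From HB Require Import structures.
Require Import Defs.
From mathcomp Require Import all_boot all_order all_algebra.
From mathcomp Require Import fingroup perm.
From mathcomp Require Import spectral sesquilinear complex.
From mathcomp Require Import all_classical all_reals convex.
From mathcomp Require Import ring lra zify.

Local Open Scope ring_scope.
Local Open Scope sesquilinear_scope.

Set Implicit Arguments.
Unset Strict Implicit.
Unset Printing Implicit Defensive.

Import Order.TTheory GRing.Theory Num.Theory.

(** * Sorting a finite family; a dimension count *)

Lemma sort_perm disp (T : orderType disp) (n : nat) (d : 'I_n -> T) :
  exists s : 'S_n, forall i j : 'I_n, (i <= j)%N -> (d (s i) <= d (s j))%O.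
Proof.
(* Sorting the indices rather than the values keeps the list duplicate-free even when [d] has ties,
   so that it defines a permutation. *)
pose r := relpre d <=%O.
have sz : size (sort r (enum 'I_n)) == n by rewrite size_sort size_enum_ord.
pose t := Tuple sz.
have inj : injective (tnth t).
  by apply/tuple_uniqP; rewrite /= sort_uniq enum_uniq.
exists (perm inj) => i j ij; rewrite !permE !(tnth_nth i).
have st : sorted r t by apply: sort_sorted => a b; exact: le_total.
apply: (sorted_leq_nth _ _ _ st) => //.
- by move=> b a c; exact: le_trans.
- by move=> a; exact: lexx.
- by rewrite inE size_tuple.
- by rewrite inE size_tuple.
Qed.

(** The conditions are (n - |A|) + (n - |B|) < n homogeneous linear equations in n unknowns. *)
Lemma common_support_neq0 (F : fieldType) n (L M : 'M[F]_n) (A B : {set 'I_n}) :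
  (n < #|A| + #|B|)%N ->
  exists h : 'cV[F]_n, [/\ h != 0, forall i, i \notin A -> (L *m h) i 0 = 0 &
                           forall i, i \notin B -> (M *m h) i 0 = 0].
Proof.
move=> AB.
pose f (D : {set 'I_n}) (i : 'I_#|~: D|) : 'I_n := enum_val i.
pose K := col_mx (rowsub (@f A) L) (rowsub (@f B) M).
have K0 : kermx K^T != 0.
  rewrite -mxrank_eq0 mxrank_ker -lt0n subn_gt0.
  apply: (leq_ltn_trans (rank_leq_col _)).
  by move: (cardsC A) (cardsC B); rewrite card_ord; lia.
pose v := nz_row (kermx K^T).
have vK : v *m K^T = 0 by apply/sub_kermxP/nz_row_sub.
have Kv : K *m v^T = 0 by rewrite -[K]trmxK -trmx_mul vK trmx0.
have vanish (D : {set 'I_n}) (N : 'M[F]_n) :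
    rowsub (@f D) N *m v^T = 0 -> forall i, i \notin D -> (N *m v^T) i 0 = 0.
  move=> N0 i; rewrite -finset.in_setC => iD.
  move: N0; rewrite mul_rowsub_mx => /matrixP/(_ (enum_rank_in iD i) 0).
  by rewrite mxE [RHS]mxE /f enum_rankK_in.
move: Kv; rewrite mul_col_mx -[0]col_mx0 => /eq_col_mx[hL hM].
exists v^T; split; [|exact: vanish|exact: vanish].
by rewrite trmx_eq0 nz_row_eq0.
Qed.

(* Locked, so that rewriting with [mulmxA] does not look inside. *)
HB.lock Definition udiag (R : rcfType) n (P : 'M[R[i]]_n) (d : 'rV[R]_n) :
    'M[R[i]]_n :=
  P ^t* *m diag_mx (map_mx (real_complex R) d) *m P.

(** * The real inner product on complex column vectors *)

Section InnerProduct.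
Variable R : rcfType.
Local Notation C := R[i].
Local Open Scope complex_scope.

(** Quadratic forms of Hermitian matrices are real, so the real part of the Hermitian product
    suffices; it is symmetric and bilinear over [R]. *)
Definition ip m (u v : 'cV[C]_m) : R := complex.Re ((u ^t* *m v) 0 0).

Lemma adjmx_mul m n p (A : 'M[C]_(m, n)) (B : 'M[C]_(n, p)) :
  (A *m B) ^t* = B ^t* *m A ^t*.
Proof. by rewrite trmx_mul map_mxM. Qed.

Lemma adjmxD m n (A B : 'M[C]_(m, n)) : (A + B) ^t* = A ^t* + B ^t*.
Proof. by rewrite raddfD/= map_mxD. Qed.

Lemma adjmxZ m n (a : R) (A : 'M[C]_(m, n)) : (a%:C *: A) ^t* = a%:C *: A ^t*.
Proof.
apply/matrixP => i j; rewrite !mxE rmorphM; congr (_ * _).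
exact: conjc_real.
Qed.

Lemma ReD (x y : C) : complex.Re (x + y) = complex.Re x + complex.Re y.
Proof. by case: x y => [a b] [c d]. Qed.

Lemma Re_sum (I : finType) (F : I -> C) :
  complex.Re (\sum_i F i) = \sum_i complex.Re (F i).
Proof. exact: (big_morph _ ReD). Qed.

Lemma ipE m (u v : 'cV[C]_m) :
  ip u v = \sum_i (complex.Re (u i 0) * complex.Re (v i 0) +
                   complex.Im (u i 0) * complex.Im (v i 0)).
Proof.
rewrite /ip !mxE Re_sum; apply: eq_bigr => i _; rewrite !mxE.
by case: (u i 0) (v i 0) => [a b] [c d] /=; ring.
Qed.

Lemma ipC m (u v : 'cV[C]_m) : ip u v = ip v u.
Proof. by rewrite !ipE; apply: eq_bigr => i _; ring. Qed.

Lemma ipDr m (u v w : 'cV[C]_m) : ip u (v + w) = ip u v + ip u w.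
Proof. by rewrite /ip mulmxDr mxE ReD. Qed.

Lemma ipZr m (u v : 'cV[C]_m) (a : R) : ip u (a%:C *: v) = a * ip u v.
Proof.
rewrite /ip -scalemxAr mxE.
by case: ((u ^t* *m v) 0 0) => [x y] /=; ring.
Qed.

Lemma ipDl m (u v w : 'cV[C]_m) : ip (u + v) w = ip u w + ip v w.
Proof. by rewrite ipC ipDr !(ipC w). Qed.

Lemma ipZl m (u v : 'cV[C]_m) (a : R) : ip (a%:C *: u) v = a * ip u v.
Proof. by rewrite ipC ipZr ipC. Qed.

Lemma ipNr m (u v : 'cV[C]_m) : ip u (- v) = - ip u v.
Proof. by rewrite -[- v]scaleN1r -[-1](rmorphN1 (real_complex R)) ipZr mulN1r. Qed.

Lemma ip_adj m n (M : 'M[C]_(m, n)) u v : ip (M *m u) v = ip u (M ^t* *m v).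
Proof. by rewrite /ip adjmx_mul mulmxA. Qed.

Lemma ip_adjr m n (M : 'M[C]_(m, n)) u v : ip u (M *m v) = ip (M ^t* *m u) v.
Proof. by rewrite ip_adj trmxCK. Qed.

Lemma ip_ge0 m (u : 'cV[C]_m) : 0 <= ip u u.
Proof. by rewrite ipE sumr_ge0// => i _; rewrite -!expr2 addr_ge0 ?sqr_ge0. Qed.

Lemma ip_gt0 m (u : 'cV[C]_m) : u != 0 -> 0 < ip u u.
Proof.
move=> u0; rewrite lt_neqAle ip_ge0 andbT eq_sym; apply: contra u0.
rewrite ipE psumr_eq0 => [/allP h|i _]; last first.
  by rewrite -!expr2 addr_ge0 ?sqr_ge0.
apply/eqP/colP => i; rewrite mxE; have := h i (mem_index_enum i).
rewrite /= -!expr2 paddr_eq0 ?sqr_ge0// !sqrf_eq0.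
by case: (u i 0) => [a b] /= /andP[/eqP-> /eqP->].
Qed.

Lemma ip_CauchySchwarz m (u v : 'cV[C]_m) : ip u v ^+ 2 <= ip u u * ip v v.
Proof.
have [->|v0] := eqVneq v 0.
  by rewrite /ip mulmx0 mulmx0 mxE /= expr0n mulr0.
have v1 := ip_gt0 v0.
(* The vector is [u] minus its projection on [v]. *)
have := ip_ge0 (u + (- (ip u v / ip v v))%:C *: v).
rewrite ipDr !ipDl !ipZr !ipZl (ipC v u).
move: (ip u u) (ip u v) (ip v v) v1 => a r b b0.
have -> : a + - (r / b) * r + (- (r / b) * r + - (r / b) * (- (r / b) * b)) =
  (a * b - r ^+ 2) / b by field; rewrite lt0r_neq0.
by rewrite pmulr_lge0 ?invr_gt0// subr_ge0.
Qed.

(** * Unitary, Hermitian and positive semidefinite matrices *)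

Lemma unitarymxKt n (P : 'M[C]_n) : P \is unitarymx -> P ^t* *m P = 1%:M.
Proof. by move=> /unitarymxP; apply: mulmx1C. Qed.

Lemma adjmx_unitary n (P : 'M[C]_n) : P \is unitarymx -> P ^t* \is unitarymx.
Proof. by rewrite trmxC_unitary. Qed.

Lemma adjmx_conj m n (U : 'M[C]_(m, n)) X :
  X ^t* = X -> (U *m X *m U ^t*) ^t* = U *m X *m U ^t*.
Proof. by move=> Xh; rewrite adjmx_mul trmxCK adjmx_mul Xh mulmxA. Qed.

Lemma ip_unitary n (P : 'M[C]_n) u v :
  P \is unitarymx -> ip (P *m u) (P *m v) = ip u v.
Proof. by move=> Pu; rewrite ip_adj mulmxA unitarymxKt// mul1mx. Qed.

Lemma hermsymmxP n (X : 'M[C]_n) : reflect (X ^t* = X) (X \is hermsymmx).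
Proof.
by apply: (iffP (is_hermitianmxP _ _ _)) => /= [|h]; rewrite expr0 scale1r.
Qed.

Lemma psdmxP n (X : 'M[C]_n) :
  psdmx X <-> X ^t* = X /\ forall v, 0 <= ip v (X *m v).
Proof.
have key : X ^t* = X -> forall v : 'cV_n, (v ^t* *m X *m v) 0 0 = (ip v (X *m v))%:C.
  move=> Xh v; rewrite /ip mulmxA; set z := _ *m v.
  have /matrixP/(_ 0 0) : z ^t* = z.
    by rewrite /z !adjmx_mul Xh trmxCK mulmxA.
  clearbody z; rewrite mxE [_^T _ _]mxE; case: (z 0 0) => a b /= [] h.
  by congr Complex; lra.
split=> -[].
  by move=> /hermsymmxP Xh Xp; split => // v; have := Xp v; rewrite key// lecR.
by move=> Xh Xp; split; [exact/hermsymmxP | move=> v; rewrite key// lecR].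
Qed.

(** * Unitary diagonalizations and forms in eigencoordinates *)

Lemma eq_conj_diag n (P : 'M[C]_n) (d e : 'rV[C]_n) :
  (forall i, d 0 i = e 0 i) ->
  P ^t* *m diag_mx d *m P = P ^t* *m diag_mx e *m P.
Proof. by move=> /rowP ->. Qed.

Lemma udiag_adj n (P : 'M[C]_n) d : (udiag P d) ^t* = udiag P d.
Proof.
rewrite udiag.unlock !adjmx_mul trmxCK mulmxA tr_diag_mx map_diag_mx.
by apply: eq_conj_diag => i; rewrite !mxE; apply: conjc_real.
Qed.

Lemma udiag_mul n (P : 'M[C]_n) d e : P \is unitarymx ->
  udiag P d *m udiag P e = udiag P (\row_i (d 0 i * e 0 i)).
Proof.
move=> /unitarymxP PP; rewrite udiag.unlock !mulmxA -[_ *m P *m P ^t*]mulmxA PP mulmx1.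
rewrite -(mulmxA (P ^t*) (diag_mx _)) mulmx_diag.
by apply: eq_conj_diag => i; rewrite !mxE; exact/esym/(rmorphM (real_complex R)).
Qed.

(** For unitary [P], the squared modulus of the coordinate of [h] along the i-th column of [P ^t*],
    an eigenvector of every [udiag P d]. *)
Definition weight n (P : 'M[C]_n) (h : 'cV[C]_n) i : R :=
  complex.Re ((P *m h) i 0) ^+ 2 + complex.Im ((P *m h) i 0) ^+ 2.

Lemma weight_ge0 n (P : 'M[C]_n) h i : 0 <= weight P h i.
Proof. by rewrite addr_ge0 ?sqr_ge0. Qed.

Lemma weight_eq0 n (P : 'M[C]_n) h i : (P *m h) i 0 = 0 -> weight P h i = 0.
Proof. by rewrite /weight => -> /=; rewrite expr0n addr0. Qed.

Lemma ip_weight n (P : 'M[C]_n) h : P \is unitarymx ->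
  ip h h = \sum_i weight P h i.
Proof.
by move=> Pu; rewrite -(ip_unitary _ _ Pu) ipE; apply: eq_bigr => i _; rewrite /weight !expr2.
Qed.

Lemma ip_udiag n (P : 'M[C]_n) d h :
  ip h (udiag P d *m h) = \sum_i d 0 i * weight P h i.
Proof.
rewrite udiag.unlock -!mulmxA -ip_adj ipE; apply: eq_bigr => i _.
rewrite /weight; move: (P *m h) => w; rewrite mul_diag_mx !mxE.
by case: (w i 0) => a b /=; ring.
Qed.

Lemma fun_calc_udiag n f (P : 'M[C]_n) d : P \is unitarymx ->
  fun_calc f (udiag P d) = udiag P (map_mx f d).
Proof.
move=> Pu; rewrite udiag.unlock (fun_calc_diag _ _ Pu).
by apply: eq_conj_diag => i; rewrite !mxE.
Qed.

Lemma hermsym_udiag n (X : 'M[C]_n) : X ^t* = X ->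
  exists P d, P \is unitarymx /\ X = udiag P d.
Proof.
move=> /hermsymmxP Xh; exists (spectralmx X), (map_mx (@complex.Re R) (spectral_diag X)).
split; first exact: spectral_unitarymx.
rewrite {1}(orthomx_spectralP (hermitian_normalmx Xh)).
rewrite (invmx_unitary (spectral_unitarymx X)) udiag.unlock.
apply: eq_conj_diag => i; rewrite !mxE.
have /mxOverP/(_ 0 i) := hermitian_spectral_diag_real Xh.
by case: (spectral_diag X 0 i) => a b; rewrite complex_real /= => /eqP ->.
Qed.

Lemma psd_udiag n (X : 'M[C]_n) : psdmx X ->
  exists P d, [/\ P \is unitarymx, X = udiag P d & forall i, 0 <= d 0 i].
Proof.
move=> /psdmxP[Xh Xp]; have [P [d [Pu XE]]] := hermsym_udiag Xh.
exists P, d; split=> // i; have := Xp (P ^t* *m delta_mx i 0).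
rewrite XE ip_udiag (bigD1 i)//= big1 => [|j ji].
  rewrite /weight mulmxA (unitarymxP Pu) mul1mx !mxE !eqxx /=.
  by rewrite expr1n expr0n/= !addr0 mulr1.
rewrite weight_eq0 ?mulr0// mulmxA (unitarymxP Pu) mul1mx !mxE.
by rewrite (negPf ji).
Qed.

Lemma psd_udiagI n (P : 'M[C]_n) (d : 'rV[R]_n) : (forall i, 0 <= d 0 i) -> psdmx (udiag P d).
Proof.
move=> d0; apply/psdmxP; split; first exact: udiag_adj.
by move=> v; rewrite ip_udiag sumr_ge0// => i _; rewrite mulr_ge0 ?weight_ge0.
Qed.

(** * The Loewner order up to unitary conjugation *)

Lemma loewner_leP n (X Y : 'M[C]_n) : X ^t* = X -> Y ^t* = Y ->
  (loewner_le X Y <-> forall v, ip v (X *m v) <= ip v (Y *m v)).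
Proof.
move=> Xh Yh; rewrite /loewner_le psdmxP; split=> [[_ h] v|h].
  by have := h v; rewrite mulmxBl ipDr ipNr subr_ge0.
split; first by rewrite raddfB/= map_mxB Xh Yh.
by move=> v; rewrite mulmxBl ipDr ipNr subr_ge0.
Qed.

(** The unitary matches the two eigenbases along [s]; both forms then carry the same weights and
    compare term by term. *)
Lemma udiag_perm_le n (P Q : 'M[C]_n) (x g : 'rV[R]_n) (s : 'S_n) :
  P \is unitarymx -> Q \is unitarymx -> (forall i, x 0 i <= g 0 (s i)) ->
  exists2 U : 'M[C]_n, U \is unitarymx &
    loewner_le (udiag Q x) (U *m udiag P g *m U ^t*).
Proof.
move=> Pu Qu xg; pose T : 'M[C]_n := perm_mx s^-1.
have Tu : T \is unitarymx.
  apply/unitarymxP; rewrite /T tr_perm_mx map_perm_mx -perm_mxM mulgV.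
  exact: perm_mx1.
have [W Wu WE] : exists2 W : 'M[C]_n, W \is unitarymx & W = P ^t* *m T *m Q.
  eexists; last reflexivity.
  exact: (mul_unitarymx (mul_unitarymx (adjmx_unitary Pu) Tu) Qu).
exists (W ^t*); first exact: adjmx_unitary.
apply/loewner_leP; [exact: udiag_adj|exact/adjmx_conj/udiag_adj|move=> v].
rewrite trmxCK -(mulmxA _ W) -(mulmxA (W ^t*)) -ip_adj !ip_udiag.
rewrite [leRHS](reindex_inj (@perm_inj _ s)) /=.
apply: ler_sum => i _; rewrite /weight.
have -> : P *m (W *m v) = row_perm s^-1 (Q *m v).
  by rewrite WE !mulmxA (unitarymxP Pu) mul1mx row_permE mulmxA.
rewrite [row_perm _ _ _ _]mxE permK ler_wpM2r//.
exact: weight_ge0.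
Qed.

(* Courant-Fischer without min-max: if [g] is the diagonal of Y in the basis P,
   a bound [g_k] for the form of X on the subspace cut out by at most as many
   constraints as there are [d_i > d_k], for every k, bounds the sorted
   eigenvalues of X.  [L] is arbitrary: for [GXG] it is not a basis of
   eigenvectors of the dominating matrix, but transports one. *)
Lemma dominated_le n (X P L : 'M[C]_n) (d g : 'rV[R]_n) :
  X ^t* = X -> P \is unitarymx ->
  (forall k (h : 'cV[C]_n), (forall i, d 0 k < d 0 i -> (L *m h) i 0 = 0) ->
    ip h (X *m h) <= g 0 k * ip h h) ->
  exists2 U : 'M[C]_n, U \is unitarymx & loewner_le X (U *m udiag P g *m U ^t*).
Proof.
move=> Xh Pu dom; have [Q [x [Qu XE]]] := hermsym_udiag Xh.
have [s smono] := sort_perm (fun i => d 0 i).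
have [t tmono] := sort_perm (fun i => x 0 i).
rewrite XE; apply: (udiag_perm_le (s := t^-1 * s)) => // i.
rewrite permM -{1}(permKV t i); move: (t^-1 i)%g => j {i}.
(* These have j + 1 and n - j elements, n + 1 in all. So some nonzero [h] has its [L]-coordinates
   supported on the j + 1 smallest values of [d] and its [Q]-coordinates on the n - j largest of
   [x]; the form of [X] at [h] is then at least [x 0 (t j)] and at most [g 0 (s j)] times |h|^2. *)
pose lo := [set k : 'I_n | (k <= j)%N]; pose hi := [set k : 'I_n | (j <= k)%N].
have cardAB : (n < #|[set s k | k in lo]| + #|[set t k | k in hi]|)%N.
  rewrite !card_imset; [|exact: perm_inj|exact: perm_inj].
  rewrite -cardsUI.
  have -> : lo :|: hi = [set: 'I_n]%SET.
    by apply/setP => k; rewrite !inE leq_total.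
  have : (0 < #|lo :&: hi|)%N by apply/card_gt0P; exists j; rewrite !inE leqnn.
  by rewrite cardsT card_ord -ltn_subLR ?subnn.
have [h [h0 hlo hhi]] := common_support_neq0 L Q cardAB.
have := dom (s j) h; rewrite XE ip_udiag (ip_weight _ Qu) => le_dom.
have le_g : \sum_i x 0 i * weight Q h i <= g 0 (s j) * \sum_i weight Q h i.
  apply: le_dom => k dk; apply: hlo; apply: contraL dk => /imsetP[l].
  by rewrite inE => lj ->; rewrite -leNgt smono.
have w0 : 0 < \sum_i weight Q h i by rewrite -ip_weight// ip_gt0.
rewrite -(ler_pM2r w0); apply: le_trans le_g; rewrite mulr_sumr.
apply: ler_sum => i _; have [/imsetP[l + ->]|iB] := boolP (i \in [set t k | k in hi]).
  by rewrite inE => jl; rewrite ler_wpM2r ?weight_ge0 ?tmono.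
by rewrite weight_eq0 ?mulr0 ?hhi.
Qed.

Lemma udiag_conj n (U P : 'M[C]_n) (d : 'rV[R]_n) :
  U *m udiag P d *m U ^t* = udiag (P *m U ^t*) d.
Proof. by rewrite udiag.unlock adjmx_mul trmxCK !mulmxA. Qed.

Lemma udiagD_const n (P : 'M[C]_n) (d : 'rV[R]_n) a : P \is unitarymx ->
  udiag P (map_mx (fun x => x + a) d) = udiag P d + a%:C%:M.
Proof.
move=> Pu; have -> : map_mx (fun x => x + a) d = d + const_mx a.
  by apply/rowP => i; rewrite !mxE.
rewrite udiag.unlock map_mxD raddfD/= mulmxDr mulmxDl; congr (_ + _).
rewrite map_const_mx diag_const_mx mul_mx_scalar -scalemxAl.
by rewrite (unitarymxKt Pu) scalemx1.
Qed.

Lemma psdmx_scalar n (a : R) : 0 <= a -> psdmx (a%:C%:M : 'M[C]_n).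
Proof.
move=> a0; apply/psdmxP; split.
  by rewrite tr_scalar_mx map_scalar_mx; congr _%:M; apply: conjc_real.
by move=> v; rewrite mul_scalar_mx ipZr mulr_ge0 ?ip_ge0.
Qed.

Lemma conj_scalar_mx n (U : 'M[C]_n) z : U \is unitarymx ->
  U *m z%:M *m U ^t* = z%:M.
Proof.
by move=> Uu; rewrite mul_mx_scalar -scalemxAl (unitarymxP Uu) scalemx1.
Qed.

Lemma ip_udiag_le n (P : 'M[C]_n) (d : 'rV[R]_n) h c : P \is unitarymx ->
  (forall i, c < d 0 i -> (P *m h) i 0 = 0) ->
  ip h (udiag P d *m h) <= c * ip h h.
Proof.
move=> Pu hc; rewrite ip_udiag (ip_weight _ Pu) mulr_sumr.
apply: ler_sum => i _; have [dc|cd] := leP (d 0 i) c.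
  by rewrite ler_wpM2r ?weight_ge0.
by rewrite weight_eq0 ?mulr0 ?hc.
Qed.

(** Cancels a factor in Cauchy-Schwarz estimates whose bound contains the estimated quantity
    itself. *)
Lemma le_of_sqr_le_mul (a b : R) : 0 <= a -> 0 <= b -> a ^+ 2 <= b * a -> a <= b.
Proof.
rewrite le_eqVlt => /predU1P[<-//|a0] _.
by rewrite expr2 ler_pM2r.
Qed.

(** * Hermitian parts and Thompson's triangle inequality *)

Definition remx n (M : 'M[C]_n) : 'M[C]_n := (2^-1)%:C *: (M + M ^t*).

Lemma remx_adj n (M : 'M[C]_n) : (remx M) ^t* = remx M.
Proof.
by rewrite /remx adjmxZ adjmxD trmxCK addrC.
Qed.

Lemma ip_remx n (M : 'M[C]_n) h : ip h (remx M *m h) = ip h (M *m h).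
Proof.
rewrite /remx -scalemxAl ipZr mulmxDl ipDr -[ip h (M ^t* *m h)]ip_adj.
by rewrite [ip (M *m h) h]ipC; field.
Qed.

Lemma remxD n (M N : 'M[C]_n) : remx (M + N) = remx M + remx N.
Proof. by rewrite /remx adjmxD addrACA scalerDr. Qed.

Lemma remx_id n (M : 'M[C]_n) : M ^t* = M -> remx M = M.
Proof.
move=> Mh; rewrite /remx Mh -mulr2n -scaler_nat scalerA.
rewrite -(rmorph_nat (real_complex R)) -rmorphM mulVf ?pnatr_eq0//.
by rewrite rmorph1 scale1r.
Qed.

(** By Cauchy-Schwarz, <h, W^* S h> = <Wh, Sh> <= |h| |Sh|, and |Sh| <= k_i |h| when [h] is a
    combination of eigenvectors of |S| with eigenvalues at most k_i. *)
Lemma remx_dominated m n (W S : 'M[C]_(m, n)) (Q : 'M[C]_n) (k : 'rV[R]_n) :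
  (forall h, ip (W *m h) (W *m h) <= ip h h) ->
  Q \is unitarymx -> (forall i, 0 <= k 0 i) ->
  S ^t* *m S = udiag Q k *m udiag Q k ->
  exists2 U : 'M[C]_n, U \is unitarymx &
    loewner_le (remx (W ^t* *m S)) (U *m udiag Q k *m U ^t*).
Proof.
move=> Wc Qu k0 SS; apply: (dominated_le (L := Q) (d := k) (remx_adj _) Qu) => i h hi.
rewrite ip_remx -mulmxA -ip_adj.
have hh := ip_ge0 h.
have Sh : ip (S *m h) (S *m h) <= k 0 i ^+ 2 * ip h h.
  rewrite ip_adj mulmxA SS udiag_mul//; apply: ip_udiag_le => // j.
  rewrite mxE => ij; apply: hi; rewrite ltNge; apply: contraL ij => ji.
  by rewrite -leNgt expr2 ler_pM.
have kh : 0 <= k 0 i * ip h h by rewrite mulr_ge0.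
apply: le_trans (ler_norm _) _; rewrite -ler_sqr ?nnegrE// real_normK ?num_real//.
apply: le_trans (ip_CauchySchwarz _ _) _.
by rewrite exprMn mulrC [ip h h ^+ 2]expr2 mulrA ler_pM ?ip_ge0.
Qed.

Lemma psdmxD n (X Y : 'M[C]_n) : psdmx X -> psdmx Y -> psdmx (X + Y).
Proof.
move=> /psdmxP[Xh Xp] /psdmxP[Yh Yp]; apply/psdmxP.
split; first by rewrite adjmxD Xh Yh.
by move=> v; rewrite mulmxDl ipDr addr_ge0.
Qed.

Lemma psdmx_conj m n (U : 'M[C]_(m, n)) X : psdmx X -> psdmx (U *m X *m U ^t*).
Proof.
move=> /psdmxP[Xh Xp]; apply/psdmxP; split; first exact: adjmx_conj.
by move=> v; rewrite -!mulmxA ip_adjr.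
Qed.

Lemma loewner_le_trans n (Y X Z : 'M[C]_n) :
  loewner_le X Y -> loewner_le Y Z -> loewner_le X Z.
Proof.
by rewrite /loewner_le => h1 h2; have := psdmxD h2 h1; rewrite addrA subrK.
Qed.

Lemma loewner_leD n (X Y X' Y' : 'M[C]_n) :
  loewner_le X Y -> loewner_le X' Y' -> loewner_le (X + X') (Y + Y').
Proof.
by rewrite /loewner_le => h1 h2; have := psdmxD h1 h2; rewrite addrACA opprD.
Qed.

Lemma loewner_le_conj m n (U : 'M[C]_(m, n)) X Y :
  loewner_le X Y -> loewner_le (U *m X *m U ^t*) (U *m Y *m U ^t*).
Proof. by move=> /(psdmx_conj U); rewrite mulmxBr mulmxBl. Qed.

Lemma abs_add_le m n (S T : 'M[C]_(m, n)) (P Q1 Q2 : 'M[C]_n) (e k1 k2 : 'rV[R]_n) :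
  P \is unitarymx -> Q1 \is unitarymx -> Q2 \is unitarymx ->
  (forall i, 0 <= k1 0 i) -> (forall i, 0 <= k2 0 i) ->
  (S + T) ^t* *m (S + T) = udiag P e *m udiag P e ->
  S ^t* *m S = udiag Q1 k1 *m udiag Q1 k1 ->
  T ^t* *m T = udiag Q2 k2 *m udiag Q2 k2 ->
  exists U V : 'M[C]_n, [/\ U \is unitarymx, V \is unitarymx &
    loewner_le (udiag P e)
      (U *m udiag Q1 k1 *m U ^t* + V *m udiag Q2 k2 *m V ^t*)].
Proof.
move=> Pu Q1u Q2u k1p k2p STE SE TE.
(* As 0^-1 = 0, the second factor is the pseudo-inverse of [udiag P e]. *)
pose W := (S + T) *m udiag P (map_mx (@GRing.inv R) e).
(* [W ^t* *m W] is diagonal in the basis [P], with entry 1 where [e] is nonzero and 0 elsewhere. *)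
have Wc h : ip (W *m h) (W *m h) <= ip h h.
  rewrite /W -!mulmxA ip_adj (mulmxA ((S + T) ^t*)) STE.
  rewrite ip_adj udiag_adj !mulmxA !udiag_mul// ip_udiag (ip_weight _ Pu).
  apply: ler_sum => i _; rewrite ler_piMl ?weight_ge0// !mxE.
  have [->|e0] := eqVneq (e 0 i) 0; first by rewrite mulr0 mul0r ler01.
  by rewrite mulVf// mul1r mulfV.
have [U Uu Ule] := remx_dominated Wc Q1u k1p SE.
have [V Vu Vle] := remx_dominated Wc Q2u k2p TE.
exists U, V; split; [exact: Uu|exact: Vu|].
(* [W ^t* *m (S + T)] is the pseudo-inverse of [udiag P e] times its square, hence [udiag P e];
   being Hermitian, it equals its Hermitian part. *)
have -> : udiag P e = remx (W ^t* *m S) + remx (W ^t* *m T).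
  rewrite -remxD -mulmxDr adjmx_mul udiag_adj -mulmxA STE mulmxA !udiag_mul//.
  rewrite remx_id ?udiag_adj//; congr udiag; apply/rowP => i; rewrite !mxE.
  by have [->|e0] := eqVneq (e 0 i) 0; rewrite ?mulr0// mulVf// mul1r.
exact: (loewner_leD Ule Vle).
Qed.

(** * The stacked matrix and the quadratic symmetric modulus *)

(** The scalar makes the modulus of this matrix exactly [qsym Z]. *)
Definition stackmx n (Z : 'M[C]_n) : 'M[C]_(n + n, n) :=
  (Num.sqrt 2^-1)%:C *: col_mx Z (Z ^t*).

Lemma stackmxD n (Y Z : 'M[C]_n) : stackmx (Y + Z) = stackmx Y + stackmx Z.
Proof. by rewrite /stackmx adjmxD -add_col_mx scalerDr. Qed.

Lemma stackmx_sqr n (Z : 'M[C]_n) :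
  (stackmx Z) ^t* *m stackmx Z = 2^-1 *: (Z ^t* *m Z + Z *m Z ^t*).
Proof.
rewrite /stackmx adjmxZ tr_col_mx map_row_mx trmxCK -scalemxAl -scalemxAr.
rewrite mul_row_col scalerA -rmorphM -expr2 sqr_sqrtr ?invr_ge0//.
by rewrite fmorphV rmorph_nat.
Qed.

(** The only place where [qsym] is unfolded; afterwards only its diagonalization and its square
    matter. *)
Lemma qsym_udiag n (Z : 'M[C]_n) :
  exists P k, [/\ P \is unitarymx, qsym Z = udiag P k, forall i, 0 <= k 0 i &
    (stackmx Z) ^t* *m stackmx Z = udiag P k *m udiag P k].
Proof.
have Zpsd : psdmx ((stackmx Z) ^t* *m stackmx Z).
  apply/psdmxP; split; first by rewrite adjmx_mul trmxCK.
  by move=> v; rewrite -mulmxA -ip_adj ip_ge0.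
have [P [d [Pu ZE d0]]] := psd_udiag Zpsd.
exists P, (map_mx Num.sqrt d); split.
- exact: Pu.
- by rewrite /qsym /sqrtmx -stackmx_sqr ZE fun_calc_udiag.
- by move=> i; rewrite mxE sqrtr_ge0.
- rewrite ZE (udiag_mul _ _ Pu); congr udiag; apply/rowP => i.
  by rewrite !mxE -expr2 sqr_sqrtr.
Qed.

End InnerProduct.

(** * Scalar inequalities for concave functions on the half-line *)

Section Concave.
Variables (R : realType) (f : R -> R).
Hypothesis f_ge0 : forall x : R, 0 <= x -> 0 <= f x.
Hypothesis f_concave : concave_nneg f.

(** If [f] dropped between [x] and [y], concavity would force it below 0 far to the right. *)
Lemma concave_nneg_le x y : 0 <= x -> x <= y -> f x <= f y.
Proof.
move=> x0 xy; rewrite leNgt; apply/negP => fyx.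
have fx0 : 0 < f x by apply: le_lt_trans fyx; rewrite f_ge0// (le_trans x0).
have fy0 : 0 <= f y by rewrite f_ge0// (le_trans x0).
(* [y] is [t x + (1-t) z] with [z >= 0] and [t f x > f y]. *)
pose t := (f x + f y) / (2 * f x).
have t1 : t < 1 by rewrite /t ltr_pdivrMr; lra.
have t0 : 0 <= t by rewrite /t divr_ge0//; lra.
have txy : t * x <= y.
  by apply: le_trans xy; rewrite ler_piMl// ltW.
have zp : 0 <= (y - t * x) / (1 - t) by rewrite divr_ge0//; lra.
have := (concave_nnegP f).1 f_concave x _ t x0 zp.
rewrite t0 (ltW t1) => /(_ isT).
rewrite mulrCA mulfV; last by rewrite subr_eq0 eq_sym lt_eqF.
rewrite mulr1 (addrC (t * x)) subrK.
have -> : t * f x = (f x + f y) / 2 by rewrite /t; field; rewrite gt_eqF.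
have t1' : 0 <= 1 - t by rewrite subr_ge0 ltW.
by move: (mulr_ge0 t1' (f_ge0 zp)); move: (_ * f _) => z; lra.
Qed.

(* Superadditivity of the perspective [(p, x) |-> p f(x/p)]; with x/0 = 0, it
   holds at [p = 0] as well because [f] is nondecreasing. *)
Lemma concave_perspectiveD p q x y : 0 <= p -> 0 <= q -> 0 <= x -> 0 <= y ->
  p * f (x / p) + q * f (y / q) <= (p + q) * f ((x + y) / (p + q)).
Proof.
move=> + + x0 y0; rewrite le_eqVlt => /predU1P[<-|p0].
  move=> q0; rewrite mul0r !add0r ler_wpM2l// concave_nneg_le ?divr_ge0//.
  by rewrite ler_wpM2r ?invr_ge0// lerDr.
rewrite le_eqVlt => /predU1P[<-|q0].
  rewrite mul0r !addr0 ler_wpM2l ?(ltW p0)// concave_nneg_le ?divr_ge0 ?(ltW p0)//.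
  by rewrite ler_wpM2r ?invr_ge0 ?(ltW p0)// lerDl.
have pq0 : 0 < p + q by rewrite addr_gt0.
have := (concave_nnegP f).1 f_concave (x / p) (y / q) (p / (p + q)).
rewrite !divr_ge0 ?(ltW p0) ?(ltW q0) ?(ltW pq0)// => /(_ isT isT).
rewrite ler_pdivrMr// mul1r lerDl (ltW q0) => /(_ isT).
have -> : p / (p + q) * (x / p) + (1 - p / (p + q)) * (y / q) = (x + y) / (p + q).
  by field; rewrite !gt_eqF.
move: (f (x / p)) (f (y / q)) (f ((x + y) / (p + q))) => a b c.
have -> : p / (p + q) * a + (1 - p / (p + q)) * b = (p * a + q * b) / (p + q).
  by field; rewrite gt_eqF.
by rewrite ler_pdivrMr// [c * _]mulrC.
Qed.

(** Jensen's inequality for a total mass of at most [N]: the missing mass is placed at 0, where [f]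
    is nonnegative, and monotonicity replaces the resulting mean by [c]. *)
Lemma concave_nneg_jensen (I : finType) (p d : I -> R) (N c : R) :
  (forall i, 0 <= p i) -> (forall i, 0 <= d i) -> 0 <= c ->
  \sum_i p i <= N -> \sum_i p i * d i <= c * N ->
  \sum_i p i * f (d i) <= f c * N.
Proof.
move=> p0 d0 c0.
(* Invariant of the summation: [P] is the partial mass and [D] the partial first moment, so no
   normalization of the weights is required. *)
pose K (a P D : R) := [/\ 0 <= P, 0 <= D & a <= P * f (D / P)].
have : K (\sum_i p i * f (d i)) (\sum_i p i) (\sum_i p i * d i).
  apply: (big_rec3 K); first by split; rewrite ?mul0r.
  move=> i a P D _ [P0 D0 aP]; split; rewrite ?addr_ge0 ?mulr_ge0//.
  have := concave_perspectiveD (p0 i) P0 (mulr_ge0 (p0 i) (d0 i)) D0.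
  apply: le_trans; apply: lerD => //.
  have [->|pi0] := eqVneq (p i) 0; first by rewrite !mul0r.
  by rewrite mulrAC mulfV// mul1r.
move: (\sum_i p i) (\sum_i p i * d i) (\sum_i _) => P D a [P0 D0 aP] PN DN.
apply: le_trans aP _.
have NP0 : 0 <= N - P by rewrite subr_ge0.
have := concave_perspectiveD P0 NP0 D0 (lexx 0).
rewrite mul0r addr0 (addrC P) subrK => h.
have : P * f (D / P) <= N * f (D / N).
  by apply: le_trans h; rewrite lerDl mulr_ge0 ?f_ge0.
move=> /le_trans; apply; rewrite mulrC.
have N0 : 0 <= N by exact: le_trans PN.
move: N0; rewrite le_eqVlt => /predU1P[<-|N0]; first by rewrite !mulr0.
by rewrite ler_wpM2r ?(ltW N0)// concave_nneg_le ?divr_ge0 ?(ltW N0)// ler_pdivrMr.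
Qed.

(** * Concave functions of positive semidefinite matrices *)

Local Notation C := R[i].

(** A nonnegative concave [f] need not be operator monotone, hence the unitary. Where [h] involves
    only eigenvalues [d] up to d_k, the hypothesis bounds the weighted mean of [e] by d_k, and
    Jensen bounds that of f(e) by f(d_k). *)
Lemma fun_monotone_dominated n (P Q : 'M[C]_n) (d e : 'rV[R]_n) :
  P \is unitarymx -> Q \is unitarymx ->
  (forall i, 0 <= d 0 i) -> (forall i, 0 <= e 0 i) ->
  loewner_le (udiag Q e) (udiag P d) ->
  exists2 U : 'M[C]_n, U \is unitarymx &
    loewner_le (udiag Q (map_mx f e)) (U *m udiag P (map_mx f d) *m U ^t*).
Proof.
move=> Pu Qu d0 e0 /loewner_leP le_ed.
apply: (dominated_le (L := P) (d := d) (udiag_adj _ _) Pu) => k h hk.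
rewrite ip_udiag mxE.
under eq_bigr do rewrite mxE mulrC.
apply: concave_nneg_jensen => //; first exact: weight_ge0.
  by rewrite -ip_weight.
under eq_bigr do rewrite mulrC.
rewrite -ip_udiag; apply: le_trans (le_ed _ _ _) _; [exact: udiag_adj..|].
exact: (ip_udiag_le Pu hk).
Qed.

Lemma summand_dominated n (P Q : 'M[C]_n) (d x : 'rV[R]_n) (Y : 'M[C]_n) :
  P \is unitarymx -> Q \is unitarymx ->
  (forall i, 0 <= d 0 i) -> (forall i, 0 <= x 0 i) -> psdmx Y ->
  udiag Q x + Y = udiag P d ->
  let G := udiag P (\row_i Num.sqrt (f (d 0 i) / d 0 i)) in
  exists2 U : 'M[C]_n, U \is unitarymx &
    loewner_le (G *m udiag Q x *m G) (U *m udiag Q (map_mx f x) *m U ^t*).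
Proof.
move=> Pu Qu d0 x0 /psdmxP[Yh Yp] XY G.
have Gh : G ^t* = G by exact: udiag_adj.
have GG : G *m G = udiag P (\row_i (f (d 0 i) / d 0 i)).
  rewrite (udiag_mul _ _ Pu); congr udiag; apply/rowP => i.
  by rewrite !mxE -expr2 sqr_sqrtr ?divr_ge0 ?f_ge0.
pose B := udiag Q (\row_i Num.sqrt (x 0 i)).
have Bh : B ^t* = B by exact: udiag_adj.
have BB : B *m B = udiag Q x.
  rewrite (udiag_mul _ _ Qu); congr udiag; apply/rowP => i.
  by rewrite !mxE -expr2 sqr_sqrtr.
clearbody G B.
have GXGh : (G *m udiag Q x *m G) ^t* = G *m udiag Q x *m G.
  by rewrite -{2 4}Gh; apply/adjmx_conj/udiag_adj.
apply: (dominated_le (L := Q *m B *m G) (d := x) GXGh Qu) => k h; rewrite mxE.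
(* [ip v v <= f (x_k) * ip h h] follows from [ip v v = ip h (G B v)] and the
   bound [|G B v|^2 <= f (x_k) * |v|^2]. *)
have [v vE] : exists v, v = B *m (G *m h) by eexists.
have -> : Q *m B *m G *m h = Q *m v by rewrite vE !mulmxA.
have -> : ip h (G *m udiag Q x *m G *m h) = ip v v.
  by rewrite -BB vE [RHS]ip_adj Bh ip_adj Gh !mulmxA.
have [w wE] : exists w, w = B *m v by eexists.
have vvE : ip v v = ip h (G *m w) by rewrite {1}vE ip_adj Bh ip_adj Gh wE.
move=> vk; have fx0 : 0 <= f (x 0 k) by exact: f_ge0.
suff rv : ip (G *m w) (G *m w) <= f (x 0 k) * ip v v.
  apply: le_of_sqr_le_mul; rewrite ?mulr_ge0 ?ip_ge0//.
  rewrite {1}vvE; apply: le_trans (ip_CauchySchwarz _ _) _.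
  by rewrite mulrAC mulrC ler_wpM2r ?ip_ge0.
(* Weights for Jensen. With K = [udiag P d] and K^+ its pseudo-inverse, they sum to <w, K^+ w>, and
   their first moment is at most |w|^2; the kernel of K gets weight 0 because 0^-1 = 0. *)
pose p i := weight P w i / d 0 i.
have p0 i : 0 <= p i by rewrite divr_ge0 ?weight_ge0.
have -> : ip (G *m w) (G *m w) = \sum_i p i * f (d 0 i).
  rewrite ip_adj Gh mulmxA GG ip_udiag; apply: eq_bigr => i _.
  by rewrite mxE /p mulrC mulrAC mulrA.
apply: concave_nneg_jensen => //.
  have [u uE] : exists u, u = udiag P (map_mx (@GRing.inv R) d) *m w by eexists.
  have -> : \sum_i p i = ip w u.
    by rewrite uE ip_udiag; apply: eq_bigr => i _; rewrite mxE mulrC.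
  (* With X = [udiag Q x] and u = K^+ w, X <= K gives |Bu|^2 = <u, Xu> <= <u, Ku> = <w, u>. Then <w,
     u> = <v, Bu> and Cauchy-Schwarz yield <w, u> <= |v|^2. *)
  have uK : ip (B *m u) (B *m u) <= ip w u.
    rewrite ip_adj Bh mulmxA BB.
    apply: (@le_trans _ _ (ip u (udiag P d *m u))).
      by rewrite -XY mulmxDl ipDr lerDl.
    rewrite uE ip_adj udiag_adj !mulmxA !(udiag_mul _ _ Pu) !ip_udiag.
    apply: ler_sum => i _; rewrite !mxE.
    have [->|di0] := eqVneq (d 0 i) 0; first by rewrite invr0 !mul0r.
    by rewrite mulVf// mul1r.
  apply: le_of_sqr_le_mul; rewrite ?ip_ge0//; first exact: le_trans (ip_ge0 _) uK.
  rewrite {1}wE ip_adj Bh; apply: le_trans (ip_CauchySchwarz _ _) _.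
  by rewrite ler_wpM2l ?ip_ge0.
apply: (@le_trans _ _ (ip w w)).
  rewrite (ip_weight _ Pu); apply: ler_sum => i _; rewrite /p.
  have [->|di0] := eqVneq (d 0 i) 0; first by rewrite mulr0 weight_ge0.
  by rewrite mulfVK.
(* The constraint on [v] enters here: |w|^2 = <v, Xv> <= x_k |v|^2. *)
by rewrite wE ip_adj Bh mulmxA BB; apply: (ip_udiag_le Qu vk).
Qed.

Lemma fun_calc_subadditive n (P Q1 Q2 : 'M[C]_n) (d x y : 'rV[R]_n) :
  f 0 = 0 ->
  P \is unitarymx -> Q1 \is unitarymx -> Q2 \is unitarymx ->
  (forall i, 0 <= d 0 i) -> (forall i, 0 <= x 0 i) -> (forall i, 0 <= y 0 i) ->
  udiag Q1 x + udiag Q2 y = udiag P d ->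
  exists U V : 'M[C]_n, [/\ U \is unitarymx, V \is unitarymx &
    loewner_le (udiag P (map_mx f d))
      (U *m udiag Q1 (map_mx f x) *m U ^t* + V *m udiag Q2 (map_mx f y) *m V ^t*)].
Proof.
move=> f0 Pu Q1u Q2u d0 x0 y0 XY.
have [U Uu Ule] := summand_dominated Pu Q1u d0 x0 (psd_udiagI Q2 y0) XY.
have YX : udiag Q2 y + udiag Q1 x = udiag P d by rewrite addrC.
have [V Vu Vle] := summand_dominated Pu Q2u d0 y0 (psd_udiagI Q1 x0) YX.
exists U, V; split; [exact: Uu|exact: Vu|].
set G := udiag P _ in Ule Vle.
(* On the kernel of [udiag P d] the left side vanishes, which agrees with the right side because
   f(0) = 0. *)
have <- : G *m udiag P d *m G = udiag P (map_mx f d).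
  rewrite !(udiag_mul _ _ Pu); congr udiag; apply/rowP => i; rewrite !mxE.
  rewrite mulrAC -expr2 sqr_sqrtr ?divr_ge0 ?f_ge0//.
  by have [->|di0] := eqVneq (d 0 i) 0; rewrite ?mulr0// mulfVK.
by rewrite -XY mulmxDr mulmxDl; exact: (loewner_leD Ule Vle).
Qed.

(** Thompson gives |S+T| <= X + Y with X, Y conjugates of |S|, |T| by [U1], [V1]; monotonicity up to
    [W] passes to f(X + Y), which subadditivity splits with [U2], [V2]. *)
Lemma fun_abs_add_le m n (S T : 'M[C]_(m, n)) (P Q1 Q2 : 'M[C]_n)
    (e x y : 'rV[R]_n) :
  f 0 = 0 ->
  P \is unitarymx -> Q1 \is unitarymx -> Q2 \is unitarymx ->
  (forall i, 0 <= e 0 i) -> (forall i, 0 <= x 0 i) -> (forall i, 0 <= y 0 i) ->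
  (S + T) ^t* *m (S + T) = udiag P e *m udiag P e ->
  S ^t* *m S = udiag Q1 x *m udiag Q1 x ->
  T ^t* *m T = udiag Q2 y *m udiag Q2 y ->
  exists U V : 'M[C]_n, [/\ U \is unitarymx, V \is unitarymx &
    loewner_le (udiag P (map_mx f e))
      (U *m udiag Q1 (map_mx f x) *m U ^t* + V *m udiag Q2 (map_mx f y) *m V ^t*)].
Proof.
move=> f0 Pu Q1u Q2u e0 x0 y0 STE SE TE.
have [U1 [V1 [U1u V1u]]] := abs_add_le Pu Q1u Q2u x0 y0 STE SE TE.
rewrite !udiag_conj => le1.
have Q1u' : Q1 *m U1 ^t* \is unitarymx.
  exact: (mul_unitarymx Q1u (adjmx_unitary U1u)).
have Q2u' : Q2 *m V1 ^t* \is unitarymx.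
  exact: (mul_unitarymx Q2u (adjmx_unitary V1u)).
have [P' [d [P'u KE d0]]] := psd_udiag
  (psdmxD (psd_udiagI (Q1 *m U1 ^t*) x0) (psd_udiagI (Q2 *m V1 ^t*) y0)).
rewrite KE in le1.
have [W Wu le2] := fun_monotone_dominated P'u Pu d0 e0 le1.
have [U2 [V2 [U2u V2u le3]]] := fun_calc_subadditive f0 P'u Q1u' Q2u' d0 x0 y0 KE.
exists (W *m U2 *m U1), (W *m V2 *m V1); split.
- exact: (mul_unitarymx (mul_unitarymx Wu U2u) U1u).
- exact: (mul_unitarymx (mul_unitarymx Wu V2u) V1u).
have := loewner_le_trans le2 (loewner_le_conj W le3).
by rewrite mulmxDr mulmxDl !udiag_conj !adjmx_mul !mulmxA.
Qed.

End Concave.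

(** * Reduction to a function vanishing at 0 *)

Theorem theorem1p13 (R : realType) (n : nat) (A B : 'M[R[i]]_n) (f : R -> R)
    (f_ge0 : forall x : R, 0 <= x -> 0 <= f x)
    (f_concave : concave_nneg f) :
  exists U V : 'M[R[i]]_n,
    [/\ U \is unitarymx, V \is unitarymx &
        loewner_le (fun_calc f (qsym (A + B)))
          (U *m fun_calc f (qsym A) *m U ^t* +
           V *m fun_calc f (qsym B) *m V ^t*)].
Proof.
have [P [e [Pu PE e0 eE]]] := qsym_udiag (A + B).
have [Q1 [x [Q1u Q1E x0 xE]]] := qsym_udiag A.
have [Q2 [y [Q2u Q2E y0 yE]]] := qsym_udiag B.
(* [g] is nonnegative because [f] is nondecreasing, and g(0) = 0; the constant returns below as a
   scalar matrix, which unitary conjugation fixes. *)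
pose g t := f t - f 0.
have g_ge0 t : 0 <= t -> 0 <= g t.
  by move=> t0; rewrite subr_ge0; apply: (concave_nneg_le f_ge0 f_concave).
have g_concave : concave_nneg g.
  apply/concave_nnegP => s t u s0 t0 u01.
  have := (concave_nnegP f).1 f_concave s t u s0 t0 u01.
  by rewrite /g; move: (f s) (f t) (f (_ + _)) (f 0) => a b c d; lra.
rewrite stackmxD in eE.
have [U [V [Uu Vu]]] := fun_abs_add_le g_ge0 g_concave (subrr _) Pu Q1u Q2u
  e0 x0 y0 eE xE yE.
move=> le_g; exists U, V; split; [exact: Uu|exact: Vu|].
have fE (Q : 'M[R[i]]_n) d : Q \is unitarymx ->
    fun_calc f (udiag Q d) = udiag Q (map_mx g d) + (f 0)%:C%C%:M.
  move=> Qu; rewrite (fun_calc_udiag _ _ Qu) -(udiagD_const _ _ Qu).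
  by congr udiag; apply/rowP => i; rewrite !mxE subrK.
(* The left side regains one copy of f(0), the right side two. *)
have f0_le : loewner_le ((f 0)%:C%C%:M) ((f 0)%:C%C%:M + (f 0)%:C%C%:M : 'M[R[i]]_n).
  by rewrite /loewner_le addrK; apply: psdmx_scalar; apply: f_ge0.
rewrite PE Q1E Q2E (fE _ _ Pu) (fE _ _ Q1u) (fE _ _ Q2u).
rewrite !mulmxDr !mulmxDl (conj_scalar_mx _ Uu) (conj_scalar_mx _ Vu) addrACA.
exact: (loewner_leD le_g f0_le).
Qed.
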